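(* Let $W$ be a group admitting an odd connected Coxeter system of rank $n\ge 2$ whose graph $\mathcal V$ is a tree. Then $W$ is co-Hopfian, i.e. every injective endomorphism of $W$ is an automorphism. In particular, $L_m$ is co-Hopfian for every $m\ge 2$.
   Context: A Coxeter system $(W,S)$ with $S=\{w_1,\dots,w_n\}$ means that $W$ has the presentation $\langle w_1,\dots,w_n \mid (w_iw_j)^{m_{ij}}=1\rangle$, where $m_{ii}=1$ and $m_{ij}=m_{ji}\in\{2,3,4,\dots\}\cup\{\infty\}$ for $i\neq j$ (no relation when $m_{ij}=\infty$). The $m_{ij}$, $i\ne j$, are the exponents and $n$ is the rank. The system is odd if every exponent is odd or $\infty$. The graph $\mathcal V_{(W,S)}$ has vertex set $\{1,\dots,n\}$ and an edge between $i\neq j$ iff $m_{ij}<\infty$; the system is connected if this graph is connected. $L_m=\langle y_1,\dots,y_{m-1}\mid y_j^2=1,\ y_iy_{i+1}y_i=y_{i+1}y_iy_{i+1}\ (1\le i\le m-2)\rangle$. *)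

(* Defs.v *)
From mathcomp Require Import all_boot.
Set Implicit Arguments. Unset Strict Implicit. Unset Printing Implicit Defensive.

Record group := Group {
  gcar :> Type;
  gmul : gcar -> gcar -> gcar;
  gone : gcar;
  ginv : gcar -> gcar;
  gmulA : forall x y z, gmul x (gmul y z) = gmul (gmul x y) z;
  gmul1x : forall x, gmul gone x = x;
  gmulx1 : forall x, gmul x gone = x;
  gmulVx : forall x, gmul (ginv x) x = gone;
  gmulxV : forall x, gmul x (ginv x) = gone }.

Fixpoint gpow (G : group) (x : G) (k : nat) : G :=
  if k is k'.+1 then gmul x (gpow x k') else gone G.

Definition is_hom (G H : group) (f : G -> H) : Prop :=
  forall x y, f (gmul x y) = gmul (f x) (f y).

(** Co-Hopfian: every injective endomorphism is an automorphism
    (a bijective endomorphism; its inverse is automatically a homomorphism). *)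
Definition co_hopfian (W : group) : Prop :=
  forall f : W -> W, is_hom f -> injective f -> bijective f.

Definition presents (k : nat) (R : forall G : group, ('I_k -> G) -> Prop)
  (W : group) (w : 'I_k -> W) : Prop :=
  R W w /\
  forall (G : group) (g : 'I_k -> G), R G g ->
    exists f : W -> G, [/\ is_hom f, (forall i, f (w i) = g i) &
      forall f' : W -> G, is_hom f' -> (forall i, f' (w i) = g i) ->
        forall x, f' x = f x].
Arguments presents {k} R W w.

(** Coxeter matrices: [m i j = None] stands for m_ij = infinity. *)
Definition coxeter_matrix (n : nat) (m : 'I_n -> 'I_n -> option nat) : Prop :=
  (forall i, m i i = Some 1) /\
  (forall i j, m i j = m j i) /\
  (forall i j, i != j -> forall k, m i j = Some k -> 2 <= k).

Definition coxeter_rels (n : nat) (m : 'I_n -> 'I_n -> option nat)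
  (G : group) (w : 'I_n -> G) : Prop :=
  forall i j k, m i j = Some k -> gpow (gmul (w i) (w j)) k = gone G.

Definition coxeter_system (n : nat) (m : 'I_n -> 'I_n -> option nat)
  (W : group) (w : 'I_n -> W) : Prop :=
  coxeter_matrix m /\ presents (coxeter_rels m) W w.
Arguments coxeter_system {n} m W w.

Definition odd_matrix (n : nat) (m : 'I_n -> 'I_n -> option nat) : Prop :=
  forall i j, i != j -> forall k, m i j = Some k -> odd k.

Definition cox_graph (n : nat) (m : 'I_n -> 'I_n -> option nat) : rel 'I_n :=
  fun i j => (i != j) && (m i j != None).

Definition graph_connected (n : nat) (e : rel 'I_n) : Prop :=
  forall i j, connect e i j.

Definition graph_acyclic (n : nat) (e : rel 'I_n) : Prop :=
  forall s : seq 'I_n, 3 <= size s -> uniq s -> ~~ cycle e s.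

Definition graph_tree (n : nat) (e : rel 'I_n) : Prop :=
  graph_connected e /\ graph_acyclic e.

(** The presentation of L_m with generators y_1..y_(m-1), indexed here
    by 'I_(m.-1) as y_0..y_(m-2). *)
Definition L_rels (m : nat) (G : group) (y : 'I_m.-1 -> G) : Prop :=
  (forall j, gmul (y j) (y j) = gone G) /\
  (forall i j : 'I_m.-1, nat_of_ord j = (nat_of_ord i).+1 ->
     gmul (gmul (y i) (y j)) (y i) = gmul (gmul (y j) (y i)) (y j)).
Arguments L_rels m G y : clear implicits.

(* Main.v *)
(* All exponents being odd, adjacent generators are conjugate inside their dihedral
   subgroup, so along the tree each edge can be slid to the root: with [t] the root
   generator and [s_v] a conjugate of [w_(par v) w_v], the group is
     < t, s_v | t^2, s_v^(M v), (t s_v)^2 >,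
   i.e. a free product P of odd cyclic groups extended by an involution [t] inverting
   each letter. On normal forms one sees: an element [p t] is an involution iff [p] is
   a palindrome, and then [p t] is conjugate to [t]; an element inverted by [t] is a
   palindrome [u c (rev u)], and it has finite order only if [u] is empty.
   Hence an injective endomorphism may be assumed to fix [t], and then sends each [s_v]
   into some <s_(p v)>. Distinct nontrivial factors do not commute, so p is injective;
   [M v <= M (p v)] and summation give equality, so each image generates <s_(p v)>. *)
Require Import Defs.
From mathcomp Require Import all_boot zify.
From Stdlib Require Import FunctionalExtensionality ProofIrrelevance.
From Stdlib Require Import ClassicalEpsilon.
Set Implicit Arguments. Unset Strict Implicit. Unset Printing Implicit Defensive.

Local Notation "x ** y" := (gmul x y) (at level 40, left associativity).
Local Notation "x ^V" := (ginv x) (at level 2, format "x ^V").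
Local Notation "x ^^ k" := (gpow x k) (at level 30, right associativity).
Local Notation "1g" := (gone _).

(** * Group identities and dihedral relations *)

Section GroupTheory.
Variable G : group.
Implicit Types x y z : G.

Lemma gmulKx x y : x^V ** (x ** y) = y.
Proof. by rewrite gmulA gmulVx gmul1x. Qed.

Lemma gmulxK x y : y ** x ** x^V = y.
Proof. by rewrite -gmulA gmulxV gmulx1. Qed.

Lemma gmulxVK x y : y ** x^V ** x = y.
Proof. by rewrite -gmulA gmulVx gmulx1. Qed.

Lemma gmulI x : injective (gmul x).
Proof. by move=> y z /(congr1 (gmul x^V)); rewrite !gmulKx. Qed.

Lemma ginv_eq x y : x ** y = 1g -> x^V = y.
Proof. by move=> xy; rewrite -[x^V]gmulx1 -xy gmulKx. Qed.

Lemma ginvK x : x^V^V = x.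
Proof. by apply: ginv_eq; rewrite gmulVx. Qed.

Lemma ginv1 : (gone G)^V = 1g.
Proof. by apply: ginv_eq; rewrite gmul1x. Qed.

Lemma ginvM x y : (x ** y)^V = y^V ** x^V.
Proof. by apply: ginv_eq; rewrite gmulA gmulxK gmulxV. Qed.

Definition gsimp := (gmulA, gmul1x, gmulx1, gmulVx, gmulxV, gmulxK, gmulxVK,
  ginvM, ginvK, ginv1).

Lemma gpow1n k : (gone G) ^^ k = 1g.
Proof. by elim: k => //= k ->; rewrite gmul1x. Qed.

Lemma gpowD x k l : x ^^ (k + l) = x ^^ k ** x ^^ l.
Proof. by elim: k => [|k IH]; rewrite ?gmul1x // addSn /= IH gmulA. Qed.

Lemma gpowM x k l : x ^^ (k * l) = (x ^^ k) ^^ l.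
Proof.
by elim: l => [|l IH]; [rewrite muln0 | rewrite mulnS gpowD IH].
Qed.

Lemma gpowSr x k : x ^^ k.+1 = x ^^ k ** x.
Proof. by rewrite -addn1 gpowD /= gmulx1. Qed.

Lemma gpow_mod x M k : x ^^ M = 1g -> x ^^ (k %% M) = x ^^ k.
Proof.
by move=> xM; rewrite {2}(divn_eq k M) mulnC gpowD gpowM xM gpow1n gmul1x.
Qed.

Lemma gpowJ x y k : (x ** y ** x^V) ^^ k = x ** y ^^ k ** x^V.
Proof.
by elim: k => [|k IH] /=; [rewrite !gsimp | rewrite IH !gsimp].
Qed.

Lemma gpowV x k : (x^V) ^^ k = (x ^^ k)^V.
Proof. by elim: k => [|k IH]; rewrite ?ginv1 // gpowSr IH /= ginvM. Qed.

Lemma invol_inv (t : G) : t ** t = 1g -> t^V = t.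
Proof. exact: ginv_eq. Qed.

Lemma inverts_swap (t s : G) : t ** t = 1g -> (t ** s) ** (t ** s) = 1g ->
  t ** s = s^V ** t.
Proof.
by move=> tt ts; rewrite -{2}(invol_inv tt) -ginvM; apply/esym/ginv_eq.
Qed.

Lemma inverts_pow (t s : G) k : t ** t = 1g -> (t ** s) ** (t ** s) = 1g ->
  t ** s ^^ k = (s ^^ k)^V ** t.
Proof.
move=> tt ts; elim: k => [|k IH]; first by rewrite /= !gsimp.
by rewrite gpowSr gmulA IH -gmulA (inverts_swap tt ts) -!gpowSr /= !gsimp.
Qed.

Lemma inverts_pow_inv (t s : G) k : t ** t = 1g ->
  (t ** s) ** (t ** s) = 1g -> t ** (s ^^ k)^V = s ^^ k ** t.
Proof.
move=> tt ts; apply: (@gmulI (s ^^ k)^V).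
by rewrite gmulKx gmulA -inverts_pow // gmulxK.
Qed.

(** Put [rho = a b]. Since [a] inverts [rho], conjugating [a] by [rho^h] gives [rho^(2h) a], which
    is [rho^-1 a = b] because [rho^(2h+1) = 1]. *)
Lemma dihedral_conj (a b : G) h : a ** a = 1g -> b ** b = 1g ->
  (a ** b) ^^ (h + h).+1 = 1g ->
  (a ** b) ^^ h ** a ** ((a ** b) ^^ h)^V = b.
Proof.
move=> aa bb; rewrite gpowSr gmulA => /ginv_eq abh.
have ainv : (a ** (a ** b)) ** (a ** (a ** b)) = 1g.
  by rewrite !gmulA aa gmul1x -(gmulA b a a) aa gmulx1.
rewrite -gmulA inverts_pow_inv // gmulA -gpowD.
by rewrite -[LHS]ginvK abh invol_inv.
Qed.

(** Moving [t] across [s^h] yields [s^(-2h) = s]: the rotation is recovered from [t] and its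
    conjugate by [s^h]. *)
Lemma dihedral_translation (t s : G) h : t ** t = 1g ->
  (t ** s) ** (t ** s) = 1g -> s ^^ (h + h).+1 = 1g ->
  t ** (s ^^ h ** t ** (s ^^ h)^V) = s.
Proof.
move=> tt ts; rewrite gpowSr => /ginv_eq sh.
rewrite -[X in t ** X]gmulA inverts_pow_inv // (gmulA (s ^^ h)) -gpowD.
by rewrite gmulA inverts_pow // sh -gmulA tt gmulx1.
Qed.

End GroupTheory.

(** * Homomorphisms, subgroups and generation *)

Lemma hom1 (G H : group) (f : G -> H) : is_hom f -> f 1g = 1g.
Proof.
by move=> hf; apply: (@gmulI _ (f 1g)); rewrite -hf !gmulx1.
Qed.

Lemma homV (G H : group) (f : G -> H) (x : G) : is_hom f -> f (x^V) = (f x)^V.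
Proof.
by move=> hf; apply/esym/ginv_eq; rewrite -hf gmulxV hom1.
Qed.

Lemma homX (G H : group) (f : G -> H) (x : G) k : is_hom f -> f (x ^^ k) = f x ^^ k.
Proof. by move=> hf; elim: k => [|k IH] /=; rewrite ?hom1 // hf IH. Qed.

Definition subgroup_pred (G : group) (P : G -> Prop) :=
  [/\ P 1g, forall x y, P x -> P y -> P (x ** y) & forall x, P x -> P (x^V)].

Lemma subgroup_pow (G : group) (P : G -> Prop) (x : G) k :
  subgroup_pred P -> P x -> P (x ^^ k).
Proof. by case=> P1 PM _ Px; elim: k => //= k; apply: PM. Qed.

Section Subgroup.
Variables (G : group) (P : G -> Prop) (subP : subgroup_pred P).

Let P1 : P 1g. Proof. by case: subP. Qed.
Let PM x y : P x -> P y -> P (x ** y). Proof. by case: subP => _ + _; apply. Qed.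
Let PV x : P x -> P (x^V). Proof. by case: subP => _ _; apply. Qed.

Lemma sub_val_inj (x y : {x | P x}) : sval x = sval y -> x = y.
Proof.
by case: x y => [x px] [y py] /= exy; subst y; rewrite (proof_irrelevance _ px py).
Qed.

Definition subgroup : group.
Proof.
refine (@Defs.Group {x | P x} (fun x y => exist _ _ (PM (svalP x) (svalP y)))
  (exist _ _ P1) (fun x => exist _ _ (PV (svalP x))) _ _ _ _ _);
  by [move=> *; apply: sub_val_inj; rewrite /= ?gsimp].
Defined.
End Subgroup.

(** The universal property gives a map from [W] to the subgroup [P]. Followed by the inclusion it
    fixes the generators, so by uniqueness it is the identity. The hypothesis on [R] lets relations
    descend to a subgroup. *)
Lemma presents_ind k (R : forall G : group, ('I_k -> G) -> Prop) (W : group)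
    (w : 'I_k -> W) (P : W -> Prop) :
  (forall (G H : group) (f : G -> H) (g : 'I_k -> G),
     is_hom f -> injective f -> R H (f \o g) -> R G g) ->
  presents R W w -> subgroup_pred P -> (forall i, P (w i)) -> forall x, P x.
Proof.
move=> Rinj [Rw univ] subP Pw x.
pose g i : subgroup subP := exist _ (w i) (Pw i).
have hv : is_hom (fun x : subgroup subP => sval x) by [].
have Rg : R (subgroup subP) g.
  by apply: (Rinj _ _ _ _ hv) => //; apply: sub_val_inj.
have [f [hf fw _]] := univ _ _ Rg.
have [f' [_ _ uf']] := univ _ _ Rw.
have <- : sval (f x) = x; last exact: svalP.
have hvf : is_hom (fun y => sval (f y)) by move=> y z; rewrite hf.
have vfw i : sval (f (w i)) = w i by rewrite fw.
by rewrite (uf' _ hvf vfw) -(uf' id).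
Qed.

(** * Permutation groups and the group of order two *)

Section Permutations.
Variable X : Type.

Record permutation := Permutation {
  pfun :> X -> X; pinv : X -> X;
  pfunK : cancel pfun pinv; pinvK : cancel pinv pfun }.

Lemma permutation_eq (p q : permutation) : pfun p =1 pfun q -> p = q.
Proof.
case: p q => [p p' pK p'K] [q q' qK q'K] /= epq.
have eq1 : p = q by apply: functional_extensionality.
subst q; have eq2 : p' = q'.
  by apply: functional_extensionality => x; rewrite -{2}[x]p'K qK.
subst q'; by rewrite (proof_irrelevance _ pK qK) (proof_irrelevance _ p'K q'K).
Qed.

Definition perm_group : group.
Proof.
refine (@Defs.Group permutation
  (fun p q => Permutation (can_comp (pfunK p) (pfunK q))
                          (can_comp (pinvK q) (pinvK p)))
  (@Permutation id id (fun=> erefl) (fun=> erefl))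
  (fun p => Permutation (pinvK p) (pfunK p)) _ _ _ _ _);
  move=> *; apply: permutation_eq => // x /=; by [apply: pfunK | apply: pinvK].
Defined.

Lemma perm_groupM (p q : perm_group) x : pfun (p ** q) x = p (q x).
Proof. by []. Qed.
End Permutations.

Definition parity_group : group.
Proof.
by refine (@Defs.Group bool addb false id _ _ _ _ _); do ?[case].
Defined.

(** * Reduced words and the action on normal forms *)

(* The model is built by letting the group act on its would-be normal forms: pairs of
   a reduced word, with letters [(j, a)] standing for [s_j^a], and an exponent of [t]. *)
Section Words.
Variables (J : finType) (M : J -> nat).
Hypothesis oddM : forall j, odd (M j).

Let M_gt0 j : 0 < M j. Proof. exact: odd_gt0. Qed.

Definition valid (x : J * nat) := 0 < x.2 < M x.1.
Definition red (l : seq (J * nat)) :=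
  sorted (fun x y => x.1 != y.1) l && all valid l.
Definition starts j (l : seq (J * nat)) := if l is x :: _ then x.1 == j else false.
Definition push j c (l : seq (J * nat)) := if c == 0 then l else (j, c) :: l.
(** Left multiplication by [s_j^b]: a leading [j]-letter absorbs [b] modulo [M j], and [push] drops
    a vanishing letter. *)
Definition act j b l :=
  if l is (i, a) :: l' then
    if i == j then push j ((a + b) %% M j) l' else push j (b %% M j) l
  else push j (b %% M j) [::].

Lemma red_cons x l : red (x :: l) = [&& valid x, ~~ starts x.1 l & red l].
Proof.
rewrite /red; case: l => [|y l] /=; rewrite ?andbT // eq_sym.
by case: (_ != _); case: (valid x); case: (valid y); rewrite /= ?andbF.
Qed.

Lemma red_push j c l : red l -> ~~ starts j l -> c < M j -> red (push j c l).
Proof.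
rewrite /push; case: eqP => // /eqP c0 rl sl cM.
by rewrite red_cons /valid /= rl sl cM lt0n c0.
Qed.

(** Allowing [c = 0] treats words with and without a leading [j]-letter uniformly, so [act] needs no
    case distinction. *)
Lemma red_split j l : red l ->
  exists c l0, [/\ c < M j, red l0, ~~ starts j l0 & l = push j c l0].
Proof.
case: l => [|[i a] l] rl; first by exists 0, [::].
have [ij|ij] := eqVneq i j; last by exists 0, ((i, a) :: l); rewrite /= ij.
subst i; move: rl; rewrite red_cons /valid /= => /and3P[/andP[a0 aM] sl rl].
by exists a, l; rewrite /push eqn0Ngt a0.
Qed.

Lemma act_push j b c l : ~~ starts j l -> c < M j ->
  act j b (push j c l) = push j ((c + b) %% M j) l.
Proof.
rewrite /push; case: (eqVneq c 0) => [->|c0] sl cM; last by rewrite /= eqxx.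
by case: l sl => [|[i a] l] //= /negPf->.
Qed.

Lemma red_act j b l : red l -> red (act j b l).
Proof.
case/(red_split j) => c [l0 [cM rl0 sl0 ->]].
by rewrite act_push // red_push // ltn_mod.
Qed.

Lemma actD j a b l : red l -> act j a (act j b l) = act j ((a + b) %% M j) l.
Proof.
case/(red_split j) => c [l0 [cM rl0 sl0 ->]].
rewrite !act_push ?ltn_mod //; congr push.
by rewrite modnDml modnDmr -addnA (addnC b).
Qed.

Lemma act0 j l : red l -> act j 0 l = l.
Proof.
case/(red_split j) => c [l0 [cM rl0 sl0 ->]].
by rewrite act_push // addn0 modn_small.
Qed.

(** Conjugation by [t]: letters are inverted in place. The inverse word is [rev (winv l)]. *)
Definition winv (l : seq (J * nat)) := [seq (x.1, M x.1 - x.2) | x <- l].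

Lemma starts_winv j l : starts j (winv l) = starts j l.
Proof. by case: l. Qed.

Lemma red_winv l : red l -> red (winv l).
Proof.
elim: l => //= x l IH; rewrite !red_cons starts_winv => /and3P[vx -> /IH->].
by rewrite andbT; move: vx; rewrite /valid /=; lia.
Qed.

Lemma winvK l : all valid l -> winv (winv l) = l.
Proof.
elim: l => //= -[j a] l IH /andP[/andP[/= a0 aM] /IH ->].
by congr ((_, _) :: _); lia.
Qed.

Lemma winv_push j c l : c < M j ->
  winv (push j c l) = push j ((M j - c) %% M j) (winv l).
Proof.
rewrite /push; case: (eqVneq c 0) => [->|c0] cM; first by rewrite subn0 modnn.
by rewrite modn_small ?ifF //=; lia.
Qed.

(** The relation [(t s_j)^2 = 1] read on exponents: shifting by one and then negating is an
    involution modulo [m]. *)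
Lemma flip_shift_mod m c : c < m ->
  (m - ((m - (c + 1) %% m) %% m + 1) %% m) %% m = c.
Proof.
move=> cm; have [ecm|neqc] := eqVneq (c + 1) m.
  rewrite ecm modnn subn0 modnn add0n; case: (ltnP 1 m) => m1.
    by rewrite (modn_small m1) modn_small; lia.
  by have m_eq1 : m = 1; [lia | rewrite m_eq1 modn1; lia].
have -> : (c + 1) %% m = c + 1 by rewrite modn_small; lia.
have -> : (m - (c + 1)) %% m = m - (c + 1) by rewrite modn_small; lia.
have -> : m - (c + 1) + 1 = m - c by lia.
case: (posnP c) => [->|c0]; first by rewrite subn0 modnn subn0 modnn.
have -> : (m - c) %% m = m - c by rewrite modn_small; lia.
by rewrite modn_small; lia.
Qed.

Definition nf_set := ({l | red l} * bool)%type.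

Lemma nf_val_inj (l l' : {l | red l}) : sval l = sval l' -> l = l'.
Proof. exact: val_inj. Qed.

Definition nf_act j b (x : nf_set) : nf_set :=
  (exist (fun l => is_true (red l)) _ (red_act j b (svalP x.1)), x.2).

Definition nf_flip (x : nf_set) : nf_set :=
  (exist (fun l => is_true (red l)) _ (red_winv (svalP x.1)), ~~ x.2).

Lemma nf_eq (x y : nf_set) : sval x.1 = sval y.1 -> x.2 = y.2 -> x = y.
Proof.
by case: x y => [l b] [l' b'] /= /nf_val_inj-> ->.
Qed.

Lemma nf_actK j a b : (a + b) %% M j = 0 -> cancel (nf_act j b) (nf_act j a).
Proof.
by move=> ab [[l rl] e]; apply: nf_eq => //=; rewrite actD // ab act0.
Qed.

Lemma nf_flipK : cancel nf_flip nf_flip.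
Proof.
move=> [[l rl] e]; apply: nf_eq => /=; last by rewrite negbK.
by rewrite winvK //; case/andP: rl.
Qed.

Lemma pred_addn1_mod j : (1 + (M j).-1) %% M j = 0.
Proof. by rewrite add1n prednK ?modnn. Qed.

Lemma addn1_pred_mod j : ((M j).-1 + 1) %% M j = 0.
Proof. by rewrite addn1 prednK ?modnn. Qed.

Definition nf_gen_s j : perm_group nf_set :=
  Permutation (nf_actK (addn1_pred_mod j)) (nf_actK (pred_addn1_mod j)).

Definition nf_gen_t : perm_group nf_set := Permutation nf_flipK nf_flipK.

Lemma nf_gen_sX j k x : (nf_gen_s j ^^ k) x = nf_act j k x.
Proof.
elim: k => [|k IH]; first by case: x => [[l rl] e]; apply: nf_eq; rewrite //= act0.
rewrite /= IH; apply: nf_eq => //=; rewrite actD ?(svalP x.1) // add1n.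
have /(red_split j)[c [l0 [cM _ sl0 ->]]] := svalP x.1.
by rewrite !act_push ?modnDmr.
Qed.

Definition star_rels (G : group) (t : G) (s : J -> G) :=
  [/\ t ** t = 1g, forall j, s j ^^ M j = 1g
    & forall j, (t ** s j) ** (t ** s j) = 1g].

Lemma nf_star_rels : star_rels nf_gen_t nf_gen_s.
Proof.
split; first by apply: permutation_eq => x; apply: nf_flipK.
  move=> j; apply: permutation_eq => x; rewrite nf_gen_sX.
  apply: nf_eq => //=; have /(red_split j)[c [l0 [cM _ sl0 ->]]] := svalP x.1.
  by rewrite act_push // modnDr modn_small.
move=> j; apply: permutation_eq => x; apply: nf_eq; last exact: negbK.
rewrite /=; have /(red_split j)[c [l0 [cM rl sl0 ->]]] := svalP x.1.
have lt_mod k : k %% M j < M j by rewrite ltn_mod.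
rewrite !(act_push, winv_push) ?starts_winv ?lt_mod //.
rewrite winvK; last by case/andP: rl.
by rewrite flip_shift_mod.
Qed.

(** The universal property of the presentation, with uniqueness of the map replaced by generation in
    the form of an induction principle. *)
Definition star_group (W : group) (t : W) (s : J -> W) : Prop :=
  [/\ star_rels t s,
      forall (G : group) (t' : G) (s' : J -> G), star_rels t' s' ->
        exists f : W -> G, [/\ is_hom f, f t = t' & forall j, f (s j) = s' j]
    & forall P : W -> Prop, subgroup_pred P -> P t -> (forall j, P (s j)) ->
        forall x, P x].

Lemma seq_ind_ends (A : Type) (P : seq A -> Prop) :
  P [::] -> (forall x, P [:: x]) ->
  (forall x v y, P v -> P (x :: rcons v y)) -> forall l, P l.
Proof.
move=> P0 P1 P2 l; elim: {l}_.+1 {-2}l (ltnSn (size l)) => // n IH.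
case=> [|x l] //; case/lastP: l => [|v y] //; rewrite /= size_rcons => lt_v.
by apply/P2/IH; lia.
Qed.

Lemma red_middle x v y : red (x :: rcons v y) -> red v.
Proof.
rewrite red_cons => /and3P[_ _]; rewrite /red -cats1 all_cat.
by case/andP=> /cat_sorted2[-> _] /andP[->].
Qed.

(** Peel off both ends of a word equal to its formal inverse. A single letter would give [M j = 2a],
    against oddness; two adjacent letters would lie in the same factor, against reducedness. *)
Lemma red_antipalindrome l : red l -> l = rev (winv l) -> l = [::].
Proof.
elim/seq_ind_ends: l => // [[j a]|x v y IH] rl.
  case=> ea; move: rl (oddM j); rewrite red_cons /valid /= ea; lia.
rewrite /winv /= map_rcons rev_cons rev_rcons rcons_cons.
case=> exy /rcons_inj[ev _]; move: (rl); rewrite (IH (red_middle rl) ev).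
by rewrite exy red_cons /= eqxx andbF.
Qed.

(** * Normal forms in a star group *)

Section StarGroup.
Variables (W : group) (t : W) (s : J -> W).
Hypothesis starW : star_group t s.

Let starR : star_rels t s. Proof. by case: starW. Qed.
Let tt : t ** t = 1g. Proof. by case: starR. Qed.
Let sM j : s j ^^ M j = 1g. Proof. by case: starR. Qed.
Let ts j : (t ** s j) ** (t ** s j) = 1g. Proof. by case: starR. Qed.

Definition ev l := foldr (fun x g => s x.1 ^^ x.2 ** g) 1g l.

Lemma ev_cat l l' : ev (l ++ l') = ev l ** ev l'.
Proof. by elim: l => [|x l IH] /=; rewrite ?gmul1x // IH gmulA. Qed.

Lemma ev_rcons l x : ev (rcons l x) = ev l ** s x.1 ^^ x.2.
Proof. by rewrite -cats1 ev_cat /= gmulx1. Qed.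

Lemma ev_push j c l : ev (push j c l) = s j ^^ c ** ev l.
Proof. by rewrite /push; case: eqP => //= ->; rewrite gmul1x. Qed.

Lemma ev_act j b l : red l -> ev (act j b l) = s j ^^ b ** ev l.
Proof.
case/(red_split j) => c [l0 [cM rl0 sl0 ->]].
by rewrite act_push // !ev_push gpow_mod // addnC gpowD gmulA.
Qed.

Lemma star_powV j a : a <= M j -> s j ^^ (M j - a) = (s j ^^ a)^V.
Proof. by move=> aM; apply/esym/ginv_eq; rewrite -gpowD subnKC. Qed.

Lemma conj_t_pow j a : t ** s j ^^ a = (s j ^^ a)^V ** t.
Proof. exact: inverts_pow. Qed.

Lemma conj_pow_t j a : s j ^^ a ** t = t ** (s j ^^ a)^V.
Proof. by rewrite inverts_pow_inv. Qed.

Lemma ev_winv l : all valid l -> ev (winv l) = t ** ev l ** t.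
Proof.
elim: l => [|[j a] l IH] /=; first by rewrite gmulx1 tt.
case/andP=> /andP[_ /= aM] /IH->.
by rewrite star_powV 1?ltnW // !gsimp conj_t_pow.
Qed.

Lemma ev_rev_winv l : all valid l -> ev (rev (winv l)) = (ev l)^V.
Proof.
elim: l => [|[j a] l IH] /=; first by rewrite ginv1.
case/andP=> /andP[_ /= aM] /IH evl.
by rewrite rev_cons ev_rcons evl ginvM /= star_powV 1?ltnW.
Qed.

Lemma red_valid l : red l -> all valid l.
Proof. by case/andP. Qed.

Lemma red_rev l : red (rev l) = red l.
Proof.
rewrite /red all_rev rev_sorted; congr (_ && _).
by apply: eq_sorted => x y; rewrite eq_sym.
Qed.

Definition nf_ev (x : nf_set) := ev (sval x.1) ** t ^^ x.2.
Definition nf_one : nf_set := (exist (fun l => is_true (red l)) [::] isT, false).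

(** Van der Waerden's argument: acting on the trivial normal form recovers the normal form of an
    element, whence uniqueness; equivariance of [nf_ev] gives existence. *)
Lemma nf_action : exists A : W -> perm_group nf_set,
  [/\ is_hom A, forall l e, red l ->
        sval (A (ev l ** t ^^ nat_of_bool e) nf_one).1 = l
        /\ (A (ev l ** t ^^ nat_of_bool e) nf_one).2 = e
    & forall g x, nf_ev (A g x) = g ** nf_ev x].
Proof.
case: starW => _ univ ind; have [A [hA At As]] := univ _ _ _ nf_star_rels.
exists A; split=> // [l e rl|].
  have At1 : A (t ^^ nat_of_bool e) nf_one = (nf_one.1, e).
    by case: e; rewrite /= ?gmulx1 ?At ?hom1 //; apply: nf_eq.
  rewrite hA perm_groupM At1; elim: l rl => [|[j a] l IH]; first by rewrite hom1.
  rewrite red_cons /= => /and3P[/andP[/= a0 aM] sl /IH[IH1 IH2]].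
  rewrite hA perm_groupM homX // As nf_gen_sX /= IH1; split=> //.
  have -> : l = push j 0 l by [].
  by rewrite act_push ?add0n ?modn_small // /push eqn0Ngt a0.
apply: ind; first split=> [x|g h Pg Ph x|g Pg x].
- by rewrite hom1 // gmul1x.
- by rewrite hA perm_groupM Pg Ph gmulA.
- by apply: (@gmulI _ g); rewrite -Pg -perm_groupM -hA gmulxV hom1 // gmulA gmulxV gmul1x.
- move=> [[l rl] e]; rewrite At /nf_ev /= ev_winv ?red_valid //.
  by case: e; rewrite /= !gsimp // -!gmulA tt gmulx1.
by move=> j [[l rl] e]; rewrite As /nf_ev /= ev_act //= gmulx1 gmulA.
Qed.

Lemma nf_exists x : exists l (e : bool), red l /\ x = ev l ** t ^^ e.
Proof.
have [A [_ _ Aev]] := nf_action; have := Aev x nf_one.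
rewrite {2}/nf_ev /= !gmulx1 => <-.
by exists (sval (A x nf_one).1), (A x nf_one).2; split=> //; exact: (svalP (A x nf_one).1).
Qed.

Lemma ev_inj l l' : red l -> red l' -> ev l = ev l' -> l = l'.
Proof.
have [A [_ Anf _]] := nf_action.
move=> /(Anf _ false)[el _] /(Anf _ false)[el' _] eq_ev.
by rewrite -el -el' eq_ev.
Qed.

(** * Involutions and torsion elements inverted by [t] *)

Lemma parity_exists : exists sg : W -> parity_group,
  [/\ is_hom sg, sg t = true & forall l, sg (ev l) = false].
Proof.
case: starW => _ univ _.
have [|sg [hsg sgt sgs]] := univ parity_group true (fun=> false).
  by split=> //= j; rewrite gpow1n.
exists sg; split=> //; elim=> [|x l IH]; first exact: hom1.
by rewrite /= hsg IH homX // sgs gpow1n.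
Qed.

(* A word [u x (rev u)] times [t] equals [u (x t) u^-1], because [t] inverts each
   letter; and [s_j^a t] is conjugate to [t] by the square root of [s_j^a]. *)
Lemma palindrome_conj l : l = rev l -> exists g, ev l ** t = g ** t ** g^V.
Proof.
elim/seq_ind_ends: l => [|[j a]|[j a] v y IH].
- by exists 1g; rewrite ginv1 gmulx1 gmul1x.
(* [(M j + 1)/2] is the inverse of 2 modulo [M j]. *)
- move=> _; exists (s j ^^ (a * (M j).+1./2)).
  rewrite -gmulA -conj_pow_t.
  have eM : a * (M j).+1./2 + a * (M j).+1./2 = M j * a + a.
    have hh : (M j).+1./2 + (M j).+1./2 = (M j).+1 by move: (oddM j); lia.
    by rewrite -mulnDr hh mulnS mulnC addnC.
  by rewrite gmulA -gpowD eM gpowD gpowM sM gpow1n gmul1x /= gmulx1.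
rewrite rev_cons rev_rcons rcons_cons => -[<- /rcons_inj[ev_v]].
have [g eg] := IH ev_v.
exists (s j ^^ a ** g).
by rewrite /= ev_rcons /= ginvM -!gmulA conj_pow_t !gmulA -(gmulA _ (ev v)) eg !gmulA.
Qed.

(** With [x = ev l], the words [winv l] and [rev (winv l)] evaluate to [t x t] and [x^-1], equal by
    hypothesis. Uniqueness of normal forms identifies the words, and [winv] cancels. *)
Lemma inverted_palindrome l : red l ->
  (t ** ev l) ** (t ** ev l) = 1g -> l = rev l.
Proof.
move=> rl /ginv_eq; rewrite ginvM (invol_inv tt) => inv_l.
have vl := red_valid rl; have vrl : all valid (rev l) by rewrite all_rev.
have evE : ev (winv l) = ev (rev (winv l)).
  by rewrite ev_winv // ev_rev_winv // -inv_l -gmulA tt gmulx1.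
rewrite -[LHS]winvK // (ev_inj _ _ evE) ?red_rev ?red_winv //.
by rewrite /winv -map_rev -/(winv _) winvK.
Qed.

(** An involution without [t] has a normal form equal to its formal inverse, so it is trivial.
    Otherwise it is [p t] with [p] inverted by [t], hence a palindrome. *)
Lemma involution_conj x : x ** x = 1g -> x <> 1g ->
  exists g, x = g ** t ** g^V.
Proof.
have [l [[] [rl ->]]] := nf_exists x => /=; rewrite gmulx1 => xx; last first.
  case; rewrite (@red_antipalindrome l) //.
  by apply: ev_inj; rewrite ?red_rev ?red_winv ?ev_rev_winv ?red_valid // (ginv_eq xx).
move=> _; apply/palindrome_conj/inverted_palindrome => //.
by apply: (@gmulI _ (ev l)); rewrite gmulx1 !gmulA; move: xx; rewrite gmulA => ->; rewrite gmul1x.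
Qed.

Lemma path_flatten_nseq c v z k : z.1 != c.1 -> path (fun x y => x.1 != y.1) c v ->
  (last c v).1 != c.1 ->
  path (fun x y : J * nat => x.1 != y.1) z (flatten (nseq k (c :: v))).
Proof.
move=> + pv lc; elim: k z => //= k IH z zc.
by rewrite cat_path zc pv IH.
Qed.

Lemma ev_flatten_nseq l k : ev (flatten (nseq k l)) = ev l ^^ k.
Proof. by elim: k => //= k IH; rewrite ev_cat IH. Qed.

(** No cancellation occurs where copies of the word meet, so its powers are again nonempty normal
    forms. *)
Lemma cyclically_reduced_torsionfree c v k : red (c :: v) -> (last c v).1 != c.1 ->
  0 < k -> ev (c :: v) ^^ k <> 1g.
Proof.
case: k => // k rcv lc _.
have [pv vv] : path (fun x y => x.1 != y.1) c v /\ all valid (c :: v) by apply/andP.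
have rk : red (flatten (nseq k.+1 (c :: v))).
  have va : all valid (flatten (nseq k (c :: v))).
    by elim: (k) => // n IH; rewrite [flatten _]/= -cat_cons all_cat vv.
  by rewrite /red [flatten _]/= -cat_cons all_cat vv va andbT /= cat_path pv path_flatten_nseq.
by rewrite -ev_flatten_nseq => /(ev_inj rk (isT : red [::])).
Qed.

Lemma double_mod_valid j a : valid (j, a) -> valid (j, (a + a) %% M j).
Proof.
rewrite /valid /= ltn_mod M_gt0 andbT => /andP[a0 aM].
rewrite lt0n; apply/negP => /eqP aa0; have := oddM j.
case: (ltnP (a + a) (M j)) => aaM; first by move: aa0; rewrite modn_small //; lia.
have : (a + a - M j) %% M j = 0 by rewrite -(modnDr (a + a - M j)) subnK.
rewrite modn_small; lia.
Qed.

(* If [x = c v c] with [v] nonempty and [c] a letter, then [x] is conjugate to the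
   cyclically reduced word [c^2 v], where [c^2 <> 1] since the exponents are odd. *)
Lemma inverted_torsion x k : odd k -> (t ** x) ** (t ** x) = 1g ->
  x ^^ k = 1g -> x = 1g \/ exists j a, x = s j ^^ a.
Proof.
move=> oddk.
have [l [e [rl ->]]] := nf_exists x => inv_l tors_l.
(* Since [k] is odd, [x^k = 1] contains [t] with the same parity as [x]. *)
have e0 : e = false.
  have [sg [hsg sgt sgl]] := parity_exists.
  have sgx : sg (ev l ** t ^^ e) = e.
    by rewrite hsg sgl; case: (e) => /=; rewrite ?gmulx1 ?hom1.
  have := hom1 hsg; rewrite -tors_l homX // sgx.
  by case: (e) => //; rewrite -[k]odd_double_half oddk -muln2 mulnC gpowD gpowM !gpow1n.
subst e; move: inv_l tors_l; rewrite /= gmulx1 => /(inverted_palindrome rl) pal tors.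
case: l rl pal tors => [|[j a] l] rl; first by left.
case/lastP: l rl => [|v y] rl; first by right; exists j, a; rewrite /= gmulx1.
rewrite rev_cons rev_rcons rcons_cons => -[ey _] tors; exfalso.
subst y; pose c := (j, (a + a) %% M j).
have rv := red_middle rl.
have vc : valid c by apply: double_mod_valid; case/andP: rl => _ /andP[].
(* If [v] were empty, the two outer letters would be adjacent in one factor. *)
have [sv lv] : ~~ starts j v /\ (last c v).1 != j.
  move: rl; rewrite red_cons => /and3P[_ svr /andP[svy _]].
  case: v svr svy {rv tors} => [|z v] /=; first by rewrite eqxx.
  by rewrite rcons_path => -> /andP[].
have rcv : red (c :: v) by rewrite red_cons vc sv.
apply: (@cyclically_reduced_torsionfree c v k) => //; first exact: odd_gt0.
have -> : ev (c :: v) = s j ^^ a ** ev ((j, a) :: rcons v (j, a)) ** (s j ^^ a)^V.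
  by rewrite /= gpow_mod // gpowD ev_rcons /= !gsimp.
by rewrite gpowJ tors gmulx1 gmulxV.
Qed.

Lemma star_order_ge j k : 0 < k -> s j ^^ k = 1g -> M j <= k.
Proof.
move=> k0 sk; rewrite leqNgt; apply/negP => kM.
have rjk : red [:: (j, k)] by rewrite red_cons /valid /= k0 kM.
suff : [:: (j, k)] = [::] by [].
by apply: (ev_inj rjk (isT : red [::])); rewrite /= gmulx1.
Qed.

Lemma star_noncommuting i j : i != j -> 1 < M i -> 1 < M j ->
  s i ** s j <> s j ** s i.
Proof.
move=> ij Mi Mj comm.
have rij x y : x != y -> 1 < M x -> 1 < M y -> red [:: (x, 1); (y, 1)].
  by move=> xy Mx My; rewrite !red_cons /valid /= eq_sym xy Mx My.
have : [:: (i, 1); (j, 1)] = [:: (j, 1); (i, 1)].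
  apply: ev_inj; [exact: rij | by apply: rij; rewrite 1?eq_sym |].
  by rewrite /= !gmulx1 comm.
by case=> eij; rewrite eij eqxx in ij.
Qed.

(** * Injective endomorphisms fixing [t] *)

Section FixedInvolution.
Variable f : W -> W.
Hypotheses (hf : is_hom f) (f_inj : injective f) (ft : f t = t).

Lemma hom_ker x : f x = 1g -> x = 1g.
Proof. by move=> fx; apply: f_inj; rewrite fx hom1. Qed.

Lemma star_inj_generators : exists (p : J -> J) (a : J -> nat),
  [/\ forall j, f (s j) = s (p j) ^^ a j, injective p
    & forall j, M (p j) = M j].
Proof.
(* When [M j = 1], [f (s j) = 1] lies in every factor; choosing the factor [j] itself keeps the
   index map injective. *)
have : forall j, exists q : J * nat, f (s j) = s q.1 ^^ q.2 /\ (M j = 1 -> q.1 = j).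
  move=> j; have s1 k : M k = 1 -> s k = 1g by move=> Mk; rewrite -(sM k) Mk /= gmulx1.
  have [M1|M1] := eqVneq (M j) 1; first by exists (j, 0); rewrite s1 // hom1.
  have [||||[i [a fs]]] := @inverted_torsion (f (s j)) (M j).
  - exact: oddM.
  - by rewrite -{1 2}ft -!hf ts hom1.
  - by rewrite -homX // sM hom1.
  - move/hom_ker => sj; have := star_order_ge (ltn0Sn 0) (etrans (gmulx1 _) sj).
    by have := M_gt0 j; move: M1; lia.
  by exists (i, a); split=> // /eqP; rewrite (negPf M1).
case/fin_all_exists=> q fq; exists (fun j => (q j).1), (fun j => (q j).2).
have le_M j : M j <= M (q j).1.
  apply: star_order_ge => //; apply: hom_ker.
  by rewrite homX // (fq j).1 -gpowM mulnC gpowM sM gpow1n.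
(* A collision cannot involve a trivial factor: [M i = 1] sends [i] to itself, then [M j <= M i = 1]
   sends [j] to itself. *)
have fs1 i j : i != j -> (q i).1 = (q j).1 -> 1 < M i.
  move=> ij eq_q; have := M_gt0 i; rewrite leq_eqVlt => /predU1P[M1|//].
  have qi := (fq i).2 (esym M1); have [Mj|Mj] := eqVneq (M j) 1.
    by move: ij; rewrite -{1}qi eq_q ((fq j).2 Mj) eqxx.
  by have := le_M j; rewrite -eq_q qi -M1; have := M_gt0 j; move: Mj; lia.
have q_inj : injective (fun j => (q j).1).
  move=> i j eq_q; apply/eqP; apply/negPn/negP => ij.
  have ji : j != i by rewrite eq_sym.
  case: (star_noncommuting ij (fs1 _ _ ij eq_q) (fs1 _ _ ji (esym eq_q))).
  by apply: f_inj; rewrite !hf !(fq _).1 eq_q -!gpowD addnC.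
split=> // [j|j]; first exact: (fq j).1.
(* The termwise inequalities have equal sums because the index map is a permutation, so each is an
   equality. *)
have leM : forall i, true -> M i <= M (q i).1 ?= iff (M i == M (q i).1) by split.
have [_] := leqif_sum leM; rewrite [X in X == _](reindex_inj q_inj) eqxx.
by move/esym/forallP/(_ j)/eqP.
Qed.

Lemma star_inj_surjective y : exists x, f x = y.
Proof.
have [p [a [fs p_inj Mp]]] := star_inj_generators.
case: (starW) => _ _ ind; move: y; apply: ind.
- split=> [|_ _ [x <-] [y <-]|_ [x <-]]; first by exists 1g; apply: hom1.
    by exists (x ** y).
  by exists (x^V); apply: homV.
- by exists t.
move=> j; have [p' _ p'K] := injF_bij p_inj.
rewrite -(p'K j); move: (p' j) => i {j}.
have sMi : s (p i) ^^ M i = 1g by rewrite -Mp.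
have [gcd_dvd_a gcd_dvd_M] := (dvdn_gcdl (a i) (M i), dvdn_gcdr (a i) (M i)).
have gcd_gt0 : 0 < gcdn (a i) (M i) by rewrite gcdn_gt0 M_gt0 orbT.
(* With [g] this gcd, [f] kills [s i ^ (M i / g)], so injectivity gives [M i <= M i / g]. *)
have co : gcdn (a i) (M i) = 1.
  have : M i <= M i %/ gcdn (a i) (M i).
    apply: star_order_ge; first by rewrite divn_gt0 // dvdn_leq.
    apply: hom_ker; rewrite homX // fs -gpowM muln_divCA_gcd.
    by rewrite gpowM sMi gpow1n.
  have := M_gt0 i; have := divnK gcd_dvd_M; nia.
(* Bezout over [nat] makes [a i * b + 1] a multiple of [M i], so [s i ^ b] is sent to the inverse of
   [s (p i)]; hence the inverse in the witness. *)
have [b _ /dvdnP[c bc]] := Bezoutl (a i) (M_gt0 i).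
exists ((s i ^^ b)^V); rewrite homV // homX // fs -gpowM.
apply: ginv_eq; rewrite -gpowSr.
have -> : (a i * b).+1 = M i * c by rewrite mulnC [M i * c]mulnC -bc gcdnC co.
by rewrite gpowM sMi gpow1n.
Qed.
End FixedInvolution.

(** * Reduction to endomorphisms fixing [t] *)

Lemma star_cohopfian : co_hopfian W.
Proof.
move=> f hf f_inj.
have t1 : t <> 1g.
  have [sg [hsg sgt _]] := parity_exists.
  by move=> t1; move: sgt; rewrite t1 hom1.
have [||g ft] := @involution_conj (f t).
- by rewrite -hf tt hom1.
- by move=> ft; apply: t1; apply: f_inj; rewrite ft hom1.
(* Composing with an inner automorphism makes [t] fixed and preserves injectivity and
   surjectivity. *)
pose f' x := g^V ** f x ** g.
have hf' : is_hom f' by move=> x y; rewrite /f' hf !gsimp.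
have f'_inj : injective f'.
  by move=> x y /(congr1 (fun z => g ** z ** g^V)); rewrite /f' !gsimp => /f_inj.
have f't : f' t = t by rewrite /f' ft !gsimp.
have f_surj y : exists x, f x = y.
  have [x f'x] := star_inj_surjective hf' f'_inj f't (g^V ** y ** g).
  exists x; move: f'x => /(congr1 (fun z => g ** z ** g^V)).
  by rewrite /f' !gsimp.
(* [bijective] asks for an inverse function, so preimages are picked by classical choice. *)
pose h y := proj1_sig (constructive_indefinite_description _ (f_surj y)).
have hK : cancel h f by move=> y; rewrite /h; case: constructive_indefinite_description.
by exists h => // x; apply: f_inj; rewrite hK.
Qed.

End StarGroup.
End Words.

(** * Rooted structure of a finite tree *)

Section RootedTrees.
Variable n : nat.
Implicit Types (e : rel 'I_n) (r v : 'I_n) (par : 'I_n -> 'I_n) (dep : 'I_n -> nat).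

(* The depth function only serves to make the parent function well-founded. *)
Definition rooted_tree e r par dep :=
  [/\ par r = r, forall v, v != r -> dep (par v) < dep v,
      forall v, v != r -> e (par v) v
    & forall i j, e i j -> (j != r /\ par j = i) \/ (i != r /\ par i = j)].

Lemma rooted_tree_ind e r par dep (P : 'I_n -> Prop) : rooted_tree e r par dep ->
  P r -> (forall v, v != r -> P (par v) -> P v) -> forall v, P v.
Proof.
case=> _ dep_par _ _ Pr Ppar v; elim: {v}_.+1 {-2}v (ltnSn (dep v)) => // k IH v vk.
have [->//|vr] := eqVneq v r; apply: Ppar => //; apply: IH.
by have := dep_par v vr; lia.
Qed.

(** Iterating [F] from a constant function, the values at depth below [k] are final after [k]
    rounds. *)
Lemma rooted_tree_rec e r par dep (A : Type) (a0 : A) (step : 'I_n -> A -> A) :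
  rooted_tree e r par dep ->
  exists g : 'I_n -> A, g r = a0 /\ forall v, v != r -> g v = step v (g (par v)).
Proof.
case=> _ dep_par _ _.
pose F g v := if v == r then a0 else step v (g (par v)).
pose gk k := iter k F (fun=> a0).
have gkE k l v : dep v < k -> dep v < l -> gk k v = gk l v.
  elim: k l v => // k IH [|l] // v vk vl; rewrite /gk /= /F.
  case: eqP => // /eqP vr; congr step; have := dep_par v vr => dv.
  by apply: IH; lia.
exists (fun v => gk (dep v).+1 v); split=> [|v vr]; first by rewrite /gk /= /F eqxx.
have -> : gk (dep v).+1 v = F (gk (dep v)) v by [].
by rewrite /F (negPf vr); congr step; apply: gkE; rewrite ?dep_par.
Qed.

Definition induced e (A : {set 'I_n}) :=
  [rel x y | [&& e x y, x \in A & y \in A]].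

(** A simple path in [A] between two distinct neighbours of [v] would close up through [v] to a
    cycle. *)
Lemma acyclic_unique_neighbour e (A : {set 'I_n}) v p q :
  symmetric e -> graph_acyclic e -> v \notin A -> p \in A -> e v p -> e v q ->
  connect (induced e A) p q -> p = q.
Proof.
move=> sym_e acyc vA pA vp vq /connectP[l0 pl0 eq_q]; move: pl0 eq_q vq.
case/shortenP=> l pl ul _ -> vq {l0 q}.
have vl : v \notin p :: l.
  rewrite inE; apply/norP; split; first by apply: contraNneq vA => ->.
  elim: l p pl {ul vq vp pA} => //= y l IH p /andP[/and3P[_ _ yA] /IH vl].
  by rewrite inE (negPf vl) orbF; apply: contraNneq vA => ->.
case: l pl ul vq vl => // y l pl ul vq vl.
have u_vl : uniq [:: v, p, y & l] by rewrite cons_uniq vl.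
have /negP[] := acyc [:: v, p, y & l] isT u_vl.
rewrite (cycle_path v) -[last _ _]/(last p (y :: l)).
rewrite [path _ _ _]/(e (last p (y :: l)) v && path e v (p :: y :: l)) sym_e vq.
have -> : path e v (p :: y :: l) = e v p && path e p (y :: l) by [].
by rewrite vp; apply: sub_path pl => a b /and3P[].
Qed.

(** Connectedness supplies an edge from [A] to a new vertex, and acyclicity makes its end in [A] the
    only neighbour there. This last point relies on connectedness of [A], which is therefore part of
    the invariant. *)
Lemma grow_rooted_tree e r k : symmetric e -> irreflexive e -> graph_tree e ->
  k < n -> exists (A : {set 'I_n}) par dep,
  [/\ #|A| = k.+1, r \in A, par r = r,
      forall v, v \in A -> v != r ->
        [/\ par v \in A, dep (par v) < dep v & e (par v) v]
    & {in A &, forall i j, connect (induced e A) i j /\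
        (e i j -> (j != r /\ par j = i) \/ (i != r /\ par i = j))}].
Proof.
move=> sym_e irr_e [conn acyc]; elim: k => [|k IH] kn.
  exists [set r], (fun=> r), (fun=> 0); split; rewrite ?cards1 ?inE //.
    by move=> v /set1P->; rewrite eqxx.
  by move=> i j /set1P-> /set1P->; rewrite irr_e.
have [A [par [dep [cA rA pr parA edgeA]]]] := IH (ltnW kn).
have /existsP[p /existsP[v /and3P[pA vA pv]]] :
    [exists p, [exists v, [&& p \in A, v \notin A & e p v]]].
  apply: contraT => noexit.
  have closA x y : x \in A -> e x y -> y \in A.
    move=> xA xy; apply/negPn; apply/negP => yA; case/negP: noexit.
    by apply/existsP; exists x; apply/existsP; exists y; rewrite xA yA.
  have : #|A| < #|'I_n| by rewrite cA card_ord.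
  suff -> : A = [set: 'I_n] by rewrite cardsT ltnn.
  apply/setP => x; rewrite inE; have /connectP[l pl ->] := conn r x.
  by elim: l (r) rA pl => //= y l IHl z zA /andP[/(closA _ _ zA) yA /IHl]; apply.
have vp : e v p by rewrite sym_e.
have neq_v x : x \in A -> x != v by move=> xA; apply: contraNneq vA => <-.
exists (v |: A), (fun x => if x == v then p else par x),
  (fun x => if x == v then (dep p).+1 else dep x); split.
- by rewrite cardsU1 vA cA.
- by rewrite setU1r.
- by rewrite (negPf (neq_v r rA)).
- move=> x /setU1P[->|xA] xr; first by rewrite eqxx setU1r // (negPf (neq_v p pA)).
  have [pxA dx ex] := parA x xA xr.
  by rewrite (negPf (neq_v x xA)) setU1r // (negPf (neq_v _ pxA)).
have sub_conn i j : connect (induced e A) i j -> connect (induced e (v |: A)) i j.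
  apply: connect_sub => x y /and3P[xy xA yA].
  by apply: connect1; rewrite /= xy !setU1r.
have vE q : q \in A -> e v q -> q = p.
  move=> qA vq; apply/esym/(acyclic_unique_neighbour sym_e acyc vA pA vp vq).
  by case: (edgeA p q pA qA).
have conn_vp : connect (induced e (v |: A)) v p.
  by apply: connect1; rewrite /= vp setU11 setU1r.
have conn_pv : connect (induced e (v |: A)) p v.
  by apply: connect1; rewrite /= pv setU11 setU1r.
have vr : v != r by rewrite eq_sym neq_v.
move=> i j /setU1P[->|iA] /setU1P[->|jA]; rewrite ?eqxx.
- by rewrite irr_e.
- rewrite (negPf (neq_v j jA)); split; last by move=> /(vE j jA)->; right.
  by apply: connect_trans conn_vp (sub_conn _ _ _); case: (edgeA p j pA jA).
- rewrite (negPf (neq_v i iA)) sym_e; split; last by move=> /(vE i iA)->; left.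
  by apply: connect_trans (sub_conn _ _ _) conn_pv; case: (edgeA i p iA pA).
rewrite (negPf (neq_v i iA)) (negPf (neq_v j jA)).
by have [/sub_conn] := edgeA i j iA jA.
Qed.

Lemma graph_tree_rooted e r : symmetric e -> irreflexive e -> graph_tree e ->
  exists par dep, rooted_tree e r par dep.
Proof.
move=> sym_e irr_e tree_e.
have n_gt0 : 0 < n by case: (n) r => [[]|].
have [|A [par [dep [cA rA pr parA edgeA]]]] :=
  @grow_rooted_tree e r n.-1 sym_e irr_e tree_e.
  by rewrite prednK.
have inA x : x \in A.
  suff -> : A = [set: 'I_n] by rewrite inE.
  by apply/eqP; rewrite eqEcard subsetT cardsT card_ord cA prednK //=.
exists par, dep; split=> // [v vr|v vr|i j]; first by case: (parA v (inA v) vr).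
  by case: (parA v (inA v) vr).
by case: (edgeA i j (inA i) (inA j)).
Qed.
End RootedTrees.

(** * Tree Coxeter groups as star groups *)

Section TreeSystems.
Variables (n : nat) (m : 'I_n -> 'I_n -> option nat) (W : group) (w : 'I_n -> W).
Variables (r : 'I_n) (par : 'I_n -> 'I_n) (dep : 'I_n -> nat).
Hypotheses (coxW : coxeter_system m W w) (odd_m : odd_matrix m).
Hypothesis tree_m : rooted_tree (cox_graph m) r par dep.

(* At the root this is [m r r = 1], so the corresponding cyclic factor is trivial. *)
Definition edge_exp v := odflt 1 (m (par v) v).

Let m_diag i : m i i = Some 1. Proof. by case: coxW => -[+ _] _; apply. Qed.
Let m_sym i j : m i j = m j i. Proof. by case: coxW => -[_ [+ _]] _; apply. Qed.
Let par_r : par r = r. Proof. by case: tree_m. Qed.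
Let par_edge v : v != r -> cox_graph m (par v) v. Proof. by case: tree_m => _ _ + _; apply. Qed.

Lemma edge_expE v : m (par v) v = Some (edge_exp v).
Proof.
rewrite /edge_exp; have [->|/par_edge] := eqVneq v r; first by rewrite par_r m_diag.
by case/andP=> _; case: (m _ _).
Qed.

Lemma odd_edge_exp v : odd (edge_exp v).
Proof.
have [->|/par_edge/andP[pv _]] := eqVneq v r; first by rewrite /edge_exp par_r m_diag.
exact: odd_m pv _ (edge_expE v).
Qed.

Let half_exp v : ((edge_exp v)./2 + (edge_exp v)./2).+1 = edge_exp v.
Proof. by have := odd_edge_exp v; lia. Qed.

Lemma coxeter_invol (G : group) (g : 'I_n -> G) i : coxeter_rels m g -> g i ** g i = 1g.
Proof. by move=> /(_ i i 1 (m_diag i)); rewrite /= gmulx1. Qed.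

Lemma coxeter_edge (G : group) (g : 'I_n -> G) v : coxeter_rels m g ->
  (g (par v) ** g v) ^^ edge_exp v = 1g.
Proof. by apply; apply: edge_expE. Qed.

(* [gw v] conjugates [t = w r] to [w v]. *)
Lemma tree_star_group : exists t s, @star_group 'I_n edge_exp W t s.
Proof.
have [_ [Rw univ]] := coxW.
pose rho v := w (par v) ** w v.
have [gw [gw_r gw_par]] := rooted_tree_rec (gone W)
  (fun v g => rho v ^^ (edge_exp v)./2 ** g) tree_m.
(* Carrying [rho v] to the root by [gw (par v)] makes [t s_v] a conjugate of the involution
   [w v]. *)
pose t := w r; pose s v := (gw (par v))^V ** rho v ** gw (par v).
have ww v : w v ** w v = 1g by apply: coxeter_invol.
have gw_conj v : w v = gw v ** t ** (gw v)^V.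
  move: v; apply: (rooted_tree_ind tree_m) => [|v vr IH].
    by rewrite gw_r ginv1 gmulx1 gmul1x.
  rewrite gw_par // ginvM -!gmulA (gmulA (gw _)) (gmulA (gw _ ** t)) -IH gmulA.
  by rewrite dihedral_conj // half_exp coxeter_edge.
have s_conj v : gw (par v) ** s v ** (gw (par v))^V = rho v by rewrite /s !gsimp.
have gw_s v : v != r -> gw v = gw (par v) ** s v ^^ (edge_exp v)./2.
  by move=> vr; rewrite gw_par // -s_conj gpowJ gmulxVK.
have t_conj v : t = (gw v)^V ** w v ** gw v by rewrite gw_conj !gsimp.
have s_r : s r = 1g by rewrite /s /rho par_r ww gmulx1 gmulVx.
exists t, s; split.
- split=> [|v|v]; first exact: ww.
    have := coxeter_edge v Rw; rewrite -/(rho v) -s_conj gpowJ.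
    move/(congr1 (fun x => (gw (par v))^V ** x ** gw (par v))).
    by rewrite !gsimp.
  have -> : t ** s v = (gw (par v))^V ** w v ** gw (par v).
    by rewrite (t_conj (par v)) /s /rho !gsimp -(gmulA _ (w (par v)) (w (par v))) ww gmulx1.
  by rewrite !gsimp -(gmulA _ (w v) (w v)) ww gmulx1 gmulVx.
- move=> G t' s' [tt' sM' ts'].
  (* [gg] copies the recursion [gw_s], so the [w' v] are the forced images of the generators. *)
  have [gg [gg_r gg_par]] := rooted_tree_rec (gone G)
    (fun v g => g ** s' v ^^ (edge_exp v)./2) tree_m.
  pose w' v := gg v ** t' ** (gg v)^V.
  have ww' v : w' v ** w' v = 1g.
    by rewrite /w' !gsimp -(gmulA _ t' t') tt' gmulx1 gmulxV.
  have edge' v : v != r -> w' (par v) ** w' v = gg (par v) ** s' v ** (gg (par v))^V.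
    move=> vr; have sM_half : s' v ^^ ((edge_exp v)./2 + (edge_exp v)./2).+1 = 1g.
      by rewrite half_exp.
    have := dihedral_translation tt' (ts' v) sM_half.
    by rewrite /w' (gg_par v vr) => {3}<-; rewrite !gsimp.
  have [|f [hf fw _]] := univ G w'.
    move=> i j k mij; have [eij|nij] := eqVneq i j.
      by move: mij; rewrite eij m_diag => -[<-]; rewrite /= gmulx1.
    have edge_pow v : v != r -> (w' (par v) ** w' v) ^^ edge_exp v = 1g.
      by move=> vr; rewrite edge' // gpowJ sM' gmulx1 gmulxV.
    have : cox_graph m i j by rewrite /cox_graph nij mij.
    (* A finite off-diagonal exponent sits on a parent edge; the opposite orientation follows by
       inversion. *)
    case: (tree_m) => _ _ _ edges /edges[[jr pj]|[ir pi]].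
      have ek : k = edge_exp j by move: (edge_expE j); rewrite pj mij => -[].
      by rewrite ek -[in w' i]pj edge_pow.
    have ek : k = edge_exp i by move: (edge_expE i); rewrite pi m_sym mij => -[].
    have -> : w' i ** w' j = (w' j ** w' i)^V by rewrite ginvM !invol_inv.
    by rewrite gpowV ek -[in w' j]pi edge_pow // ginv1.
  have f_rho v : v != r -> f (rho v) = gg (par v) ** s' v ** (gg (par v))^V.
    by move=> vr; rewrite hf !fw edge'.
  have f_gw v : f (gw v) = gg v.
    move: v; apply: (rooted_tree_ind tree_m) => [|v vr IH]; first by rewrite gw_r gg_r hom1.
    by rewrite (gw_par v vr) (gg_par v vr) hf IH homX // (f_rho v vr) gpowJ gmulxVK.
  exists f; split=> // [|v]; first by rewrite fw /w' gg_r ginv1 gmulx1 gmul1x.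
  (* At the root the exponent is 1, so [s r] and [s' r] are both trivial. *)
  have [->|vr] := eqVneq v r.
    by have := sM' r; rewrite s_r hom1 // /edge_exp par_r m_diag /= gmulx1.
  by rewrite /s 2!hf homV // f_gw (f_rho v vr) !gsimp.
move=> P subP Pt Ps; have [_ PM PV] := subP.
apply: (presents_ind _ (conj Rw univ) subP) => [G H f g hf f_inj Rfg i j k mij|].
  by apply: f_inj; rewrite homX // hf hom1 //; apply: Rfg.
(* Each [w v] is a conjugate of [t] by a product of powers of the [s u]. *)
move=> v; rewrite gw_conj; suff Pgw : P (gw v) by apply: (PM _ _ (PM _ _ Pgw Pt) (PV _ Pgw)).
move: v; apply: (rooted_tree_ind tree_m) => [|v vr IH]; first by rewrite gw_r; case: subP.
by rewrite gw_s //; apply: PM => //; apply: subgroup_pow.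
Qed.

Lemma tree_cohopfian : co_hopfian W.
Proof.
have [t [s starW]] := tree_star_group.
exact: (star_cohopfian odd_edge_exp starW).
Qed.
End TreeSystems.

(** * The groups [L_m] as Coxeter groups of a path *)

Definition path_matrix n (i j : 'I_n) : option nat :=
  if i == j then Some 1
  else if (i.+1 == j) || (j.+1 == i) then Some 3 else None.

(** The parent is the predecessor, and [0.-1 = 0] makes the root its own parent. *)
Lemma path_matrix_rooted n (r : 'I_n) : r = 0 :> nat -> exists par dep,
  rooted_tree (cox_graph (@path_matrix n)) r par dep.
Proof.
case: n r => [[]//|n] r r0.
have rE (i : 'I_n.+1) : (i != r) = (0 < i) by rewrite -(inj_eq (@ord_inj _)) r0 lt0n.
have parE (v : 'I_n.+1) : (inord v.-1 : 'I_n.+1) = v.-1 :> nat.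
  by rewrite inordK //; have := ltn_ord v; lia.
exists (fun v => inord v.-1), (fun v => v : nat); split.
- by apply: ord_inj; rewrite parE (_ : nat_of_ord r = 0).
- by move=> v; rewrite rE parE; lia.
- move=> v; rewrite rE /cox_graph /path_matrix -(inj_eq (@ord_inj _)) parE => v0.
  have -> : (v.-1 == v) = false by lia.
  by rewrite ifT //; lia.
move=> i j; rewrite /cox_graph /path_matrix => /andP[/negPf->].
by case: ifP => // /orP[] /eqP ij _; [left | right]; rewrite rE -ij /= inord_val.
Qed.

(** For involutions, [a b a = b a b] amounts to [(a b)^3 = 1]. Nonconsecutive generators satisfy no
    relation, hence the exponent [None] rather than 2. *)
Lemma L_rels_coxeter k (G : group) (y : 'I_k.-1 -> G) :
  L_rels k G y <-> coxeter_rels (@path_matrix k.-1) y.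
Proof.
split=> [[yy braid] i j l|Ry].
  have braid3 (a b : 'I_k.-1) : b = a.+1 :> nat -> (y a ** y b) ^^ 3 = 1g.
    move=> /braid ab; rewrite /= gmulx1 !gmulA ab.
    by rewrite -(gmulA _ (y b) (y b)) yy gmulx1 -(gmulA _ (y a) (y a)) yy gmulx1 yy.
  rewrite /path_matrix; case: eqP => [<- [<-]|_]; first by rewrite /= gmulx1.
  case: ifP => // /orP[] /eqP ij [<-]; first by exact: braid3 (esym ij).
  have -> : y i ** y j = (y j ** y i)^V by rewrite ginvM !(invol_inv (yy _)).
  by rewrite gpowV (braid3 _ _ (esym ij)) ginv1.
have yy j : y j ** y j = 1g.
  by have := Ry j j 1; rewrite /path_matrix eqxx /= gmulx1; apply.
split=> // i j ij; have := Ry i j 3; rewrite /path_matrix -(inj_eq (@ord_inj _)) ij.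
rewrite eqxx ifF; last by lia.
move=> /(_ erefl); rewrite /= gmulx1 !gmulA => /(congr1 (fun x => x ** y j ** y i ** y j)).
rewrite gmul1x -!gmulA; rewrite (gmulA (y j) (y j)) yy gmul1x (gmulA (y i) (y i)) yy.
by rewrite gmul1x yy gmulx1.
Qed.

Lemma cox_graph_sym n (m : 'I_n -> 'I_n -> option nat) :
  coxeter_matrix m -> symmetric (cox_graph m).
Proof. by case=> _ [ms _] i j; rewrite /cox_graph ms eq_sym. Qed.

Theorem theorem5p8 :
  (forall (n : nat) (m : 'I_n -> 'I_n -> option nat) (W : group) (w : 'I_n -> W),
     2 <= n -> coxeter_system m W w -> odd_matrix m ->
     graph_tree (cox_graph m) -> co_hopfian W) /\
  (forall (m : nat) (L : group) (y : 'I_m.-1 -> L),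
     2 <= m -> presents (L_rels m) L y -> co_hopfian L).
Proof.
split=> [n m W w n2 coxW odd_m tree_m|k L y k2 [Ry univ]].
  have irr_m : irreflexive (cox_graph m) by move=> i; rewrite /cox_graph eqxx.
  have [par [dep rooted]] :=
    graph_tree_rooted (Ordinal (ltnW n2)) (cox_graph_sym (proj1 coxW)) irr_m tree_m.
  exact: tree_cohopfian coxW odd_m rooted.
(* For [k = 2] the rank is one, so the rooted version is applied directly instead of the first
   claim. *)
have k1 : 0 < k.-1 by lia.
have [par [dep rooted]] := @path_matrix_rooted _ (Ordinal k1) erefl.
apply: tree_cohopfian rooted.
  split; last first.
    split=> [|G g Rg]; first exact: (proj1 (L_rels_coxeter _) Ry).
    exact: univ (proj2 (L_rels_coxeter _) Rg).
  split=> [i|]; first by rewrite /path_matrix eqxx.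
  split=> [i j|i j /negPf ij l]; rewrite /path_matrix.
    by rewrite (eq_sym j) (orbC (j.+1 == i)).
  by rewrite ij; case: ifP => // _ [<-].
by move=> i j /negPf ij l; rewrite /path_matrix ij; case: ifP => // _ [<-].
Qed.
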